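(* Assume the hypotheses of Theorem 6: $(P_{\mathcal C})$ under Assumption A; $\{x^k\}$, $\{y^k\}$ ($y^k\in\partial h(x^k)$) well-defined bounded DCA sequences from $x^0\in\operatorname{dom}\partial h$; $f$ continuous on $\operatorname{dom}f$; $\rho_g+\rho_h>0$; $h$ differentiable with locally Lipschitz continuous gradient. Let $f^*=\lim_kf(x^k)$ and $\Psi=f+\chi_{\mathcal C}-f^*$, and suppose $\Psi$ satisfies the KL property around the set of cluster points of $\{x^k\}$ with $\varphi(t)=Mt^{1-\theta}$, i.e., there exist $M>0$, $\theta\in[0,1)$, $\eta\in(0,\infty]$ and a neighbourhood $\mathcal V$ of the set of cluster points of $\{x^k\}$ such that $\varphi'(\Psi(x))\operatorname{dist}(0,\partial^L\Psi(x))\ge1$ for all $x\in\mathcal V$ with $\Psi(x)\in(0,\eta)$. Then: (i) if $\theta=0$, $f(x^k)=f^*$ for all sufficiently large $k$; (ii) if $\theta\in(0,\tfrac12]$, there is $q\in(0,1)$ with $f(x^k)-f^*=O(q^k)$ as $k\to\infty$; (iii) if $\theta\in(\tfrac12,1)$, then $f(x^k)-f^*=O\big(k^{\frac{1}{1-2\theta}}\big)$ as $k\to\infty$.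
   Context: $\Gamma_0(\mathbb{R}^n)$ is the set of proper, lower semicontinuous, convex functions $\mathbb{R}^n\to(-\infty,\infty]$. Let $g,h\in\Gamma_0(\mathbb{R}^n)$, $\mathcal C\subseteq\mathbb R^n$ nonempty closed convex with indicator $\chi_{\mathcal C}$, and $f=g-h$ with convention $\infty-\infty=\infty$. Problem $(P_{\mathcal C})$: $\inf\{f(x):x\in\mathcal C\}$ (standard program: $\mathcal C=\mathbb R^n$). Assumption A: $g,h\in\Gamma_0(\mathbb{R}^n)$ and the solution set of $(P_{\mathcal C})$ is nonempty. DCA: given $x^0\in\operatorname{dom}\partial h$, for $k=0,1,\dots$ choose $y^k\in\partial h(x^k)$ and $x^{k+1}\in\operatorname{argmin}\{g(x)-\langle y^k,x\rangle: x\in\mathcal C\}$. Convexity moduli: $\rho_g,\rho_h\ge0$ constants with $g(z)\ge g(x)+\langle w,z-x\rangle+\frac{\rho_g}{2}\|z-x\|^2$ and $h(z)\ge h(x)+\langle v,z-x\rangle+\frac{\rho_h}{2}\|z-x\|^2$ for all $x,z\in\mathcal C$, $w\in\partial g(x)$, $v\in\partial h(x)$. Fréchet and limiting subdifferentials: $\partial^F\phi(x)=\{y:\liminf_{z\to x,z\neq x}\frac{\phi(z)-\phi(x)-\langle y,z-x\rangle}{\|z-x\|}\ge0\}$, $\partial^L\phi(x)=\{y:\exists x^j\to x,\ \phi(x^j)\to\phi(x),\ y^j\in\partial^F\phi(x^j),\ y^j\to y\}$; $\operatorname{dist}(0,S)=\inf\{\|y\|:y\in S\}$. *)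

(* Defs.v *)
From HB Require Import structures.
From mathcomp Require Import all_boot all_order all_algebra.
From mathcomp Require Import all_classical all_reals all_analysis.
Set Implicit Arguments. Unset Strict Implicit. Unset Printing Implicit Defensive.
Import Order.TTheory GRing.Theory Num.Theory.
Local Open Scope classical_set_scope.
Local Open Scope ring_scope.

Section Defs.
Variables (R : realType) (n : nat).
Notation vec := 'rV[R]_n.

Definition dotv (u v : vec) : R := \sum_(i < n) u ord0 i * v ord0 i.
Definition enorm (u : vec) : R := Num.sqrt (dotv u u).

Definition vcvg (u : nat -> vec) (l : vec) : Prop :=
  forall e : R, 0 < e -> exists N : nat, forall k, (N <= k)%N -> enorm (u k - l) < e.

Definition eclosed (C : set vec) : Prop :=
  forall x, (forall e : R, 0 < e -> exists z, C z /\ enorm (z - x) < e) -> C x.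
Definition eopen (U : set vec) : Prop :=
  forall x, U x -> exists r : R, 0 < r /\ forall z, enorm (z - x) < r -> U z.
Definition nbhd_of_set (V S : set vec) : Prop :=
  exists U, eopen U /\ S `<=` U /\ U `<=` V.

Definition proper_fun (g : vec -> \bar R) : Prop :=
  (forall x, g x != -oo%E) /\ (exists x, g x \is a fin_num).
Definition lsc (g : vec -> \bar R) : Prop :=
  forall x (a : \bar R), (a < g x)%E ->
    exists d : R, 0 < d /\ forall z, enorm (z - x) < d -> (a < g z)%E.
Definition convex_efun (g : vec -> \bar R) : Prop :=
  forall (x z : vec) (t : R), 0 <= t <= 1 ->
    (g (t *: x + (1 - t) *: z)%R <= t%:E * g x + (1 - t)%:E * g z)%E.
Definition Gamma0 (g : vec -> \bar R) : Prop :=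
  proper_fun g /\ lsc g /\ convex_efun g.

Definition esubdiff (g : vec -> \bar R) (x : vec) : set vec :=
  [set w | g x \is a fin_num /\ forall z, (g x + (dotv w (z - x)%R)%:E <= g z)%E].

Definition dom_subdiff (g : vec -> \bar R) : set vec :=
  [set x | exists w, esubdiff g x w].

Definition chi (C : set vec) (x : vec) : \bar R :=
  if `[< C x >] then 0%E else +oo%E.

(* DC objective with convention oo - oo = oo (here h is finite) *)
Definition fdc (g : vec -> \bar R) (h : vec -> R) (x : vec) : \bar R :=
  (g x - (h x)%:E)%E.

(* Frechet subdifferential: liminf_{z->x, z<>x} (phi z - phi x - <y,z-x>)/|z-x| >= 0 *)
Definition frechet_subdiff (phi : vec -> \bar R) (x : vec) : set vec :=
  [set y | phi x \is a fin_num /\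
     forall e : R, 0 < e -> exists d : R, 0 < d /\
       forall z, 0 < enorm (z - x) < d ->
         ((- (e * enorm (z - x)))%:E <= phi z - phi x - (dotv y (z - x)%R)%:E)%E].

Definition limiting_subdiff (phi : vec -> \bar R) (x : vec) : set vec :=
  [set y | exists (xs ys : nat -> vec),
     vcvg xs x /\ (fun j => phi (xs j)) @ \oo --> phi x /\
     (forall j, frechet_subdiff phi (xs j) (ys j)) /\ vcvg ys y].

(* dist(0, S) = inf {|y| : y in S}  (= +oo if S is empty) *)
Definition dist0 (S : set vec) : \bar R :=
  ereal_inf [set (enorm y)%:E | y in S].

Definition cluster_points (x : nat -> vec) : set vec :=
  [set p | forall e : R, 0 < e -> forall N : nat,
     exists k, (N <= k)%N /\ enorm (x k - p) < e].

End Defs.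

(* Main.v *)
(** Since [x^(k+1)] minimises [g - <y^k, .>] on [C], the objective decreases by at
    least [h(x^(k+1)) - h(x^k) - <grad h(x^k), x^(k+1) - x^k>].  The gradient of [h]
    is Lipschitz on a ball containing the (bounded) iterates, hence cocoercive
    there, so this decrease dominates [a * |grad h(x^(k+1)) - grad h(x^k)|^2].  On the
    other hand [y^k - grad h(x^(k+1)) = grad h(x^k) - grad h(x^(k+1))] is a Frechet
    subgradient of [Psi] at [x^(k+1)].  The KL inequality therefore turns into the
    scalar recursion [d_(k+1)^(2 theta) <= c (d_k - d_(k+1))] for
    [d_k = f(x^k) - f*], from which the three rates follow. *)
Require Import Defs.
From HB Require Import structures.
From mathcomp Require Import all_boot all_order all_algebra.
From mathcomp Require Import all_classical all_reals all_analysis.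
From mathcomp Require Import ring lra.
Import Order.TTheory GRing.Theory Num.Theory.
Import numFieldNormedType.Exports.
Local Open Scope classical_set_scope.
Local Open Scope ring_scope.

(** * Euclidean geometry of row vectors, and cluster points of bounded sequences *)

Section Euclidean.
Context {R : realType} {n : nat}.
Implicit Types u v w : 'rV[R]_n.

Lemma dotvC u v : dotv u v = dotv v u.
Proof. by apply: eq_bigr => i _; rewrite mulrC. Qed.

Lemma dotvDl u v w : dotv (u + v) w = dotv u w + dotv v w.
Proof. by rewrite -big_split; apply: eq_bigr => i _; rewrite mxE mulrDl. Qed.

Lemma dotvZl a u w : dotv (a *: u) w = a * dotv u w.
Proof. by rewrite mulr_sumr; apply: eq_bigr => i _; rewrite mxE mulrA. Qed.

Lemma dotvNl u w : dotv (- u) w = - dotv u w.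
Proof. by rewrite -scaleN1r dotvZl mulN1r. Qed.

Lemma dotvBl u v w : dotv (u - v) w = dotv u w - dotv v w.
Proof. by rewrite dotvDl dotvNl. Qed.

Lemma dotvZr a u w : dotv u (a *: w) = a * dotv u w.
Proof. by rewrite dotvC dotvZl dotvC. Qed.

Lemma dotvDr u v w : dotv w (u + v) = dotv w u + dotv w v.
Proof. by rewrite dotvC dotvDl !(dotvC w). Qed.

Lemma dotvBr u v w : dotv w (u - v) = dotv w u - dotv w v.
Proof. by rewrite dotvC dotvBl !(dotvC w). Qed.

Lemma dotv_ge0 u : 0 <= dotv u u.
Proof. by apply: sumr_ge0 => i _; rewrite -expr2 sqr_ge0. Qed.

Lemma enorm_ge0 u : 0 <= enorm u.
Proof. exact: sqrtr_ge0. Qed.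

Lemma enorm_sqr u : enorm u ^+ 2 = dotv u u.
Proof. by rewrite sqr_sqrtr // dotv_ge0. Qed.

Lemma ler_coord_enorm u i : `|u ord0 i| <= enorm u.
Proof.
rewrite -sqrtr_sqr ler_wsqrtr // /dotv (bigD1 i) //= expr2 lerDl.
by apply: sumr_ge0 => j _; rewrite -expr2 sqr_ge0.
Qed.

Lemma enorm_eq0 u : enorm u = 0 -> u = 0.
Proof.
move=> u0; apply/rowP => i; rewrite mxE; apply/eqP.
by rewrite -normr_le0 (le_trans (ler_coord_enorm u i)) // u0.
Qed.

Lemma enormZ a u : enorm (a *: u) = `|a| * enorm u.
Proof.
by rewrite /enorm dotvZl dotvZr mulrA -expr2 sqrtrM ?sqr_ge0// sqrtr_sqr.
Qed.

Lemma enormN u : enorm (- u) = enorm u.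
Proof. by rewrite -scaleN1r enormZ normrN1 mul1r. Qed.

Lemma enormBC u v : enorm (u - v) = enorm (v - u).
Proof. by rewrite -enormN opprB. Qed.

Lemma enorm0 : enorm (0 : 'rV[R]_n) = 0.
Proof. by rewrite -(scale0r 0) enormZ normr0 mul0r. Qed.

Lemma cauchy_schwarz u v : dotv u v <= enorm u * enorm v.
Proof.
have [/eqP|u0] := eqVneq (enorm u) 0.
  by move=> /eqP/enorm_eq0 ->; rewrite enorm0 -(scale0r 0) dotvZl !mul0r.
have [/eqP|v0] := eqVneq (enorm v) 0.
  by move=> /eqP/enorm_eq0 ->; rewrite enorm0 -(scale0r 0) dotvZr mul0r mulr0.
have uv : 0 < enorm u * enorm v.
  by rewrite mulr_gt0// lt0r enorm_ge0 ?u0 ?v0.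
(* This square expands to twice [enorm u * enorm v] times [enorm u * enorm v - dotv u v]. *)
have := dotv_ge0 (enorm v *: u - enorm u *: v).
rewrite !(dotvBl, dotvBr, dotvZl, dotvZr) -!enorm_sqr (dotvC v u) => H.
rewrite -subr_ge0 -(pmulr_rge0 _ uv); nra.
Qed.

Lemma ler_enormD u v : enorm (u + v) <= enorm u + enorm v.
Proof.
rewrite -(@ler_pXn2r _ 2) ?nnegrE ?addr_ge0 ?enorm_ge0//.
rewrite sqrrD !enorm_sqr dotvDl !dotvDr (dotvC v u).
have := cauchy_schwarz u v; lra.
Qed.

Lemma ler_enorm_dist u v w : enorm (u - w) <= enorm (u - v) + enorm (v - w).
Proof. by rewrite (le_trans _ (ler_enormD _ _))// addrA subrK. Qed.

Lemma ler_enormB u v : enorm (u - v) <= enorm u + enorm v.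
Proof. by rewrite (le_trans (ler_enormD _ _))// enormN. Qed.

(** The crude factor [n.+1] avoids a square root and stays nonzero for [n = 0], so it can be divided
    by. *)
Lemma ler_enorm_coord u a : 0 <= a -> (forall i, `|u ord0 i| <= a) ->
  enorm u <= n.+1%:R * a.
Proof.
move=> a0 ua; rewrite -[leRHS]ger0_norm ?mulr_ge0// -sqrtr_sqr ler_wsqrtr//.
have -> : (n.+1%:R * a) ^+ 2 = n.+1%:R ^+ 2 * (a ^+ 2) by rewrite exprMn.
apply: (@le_trans _ _ (n%:R * a ^+ 2)); last first.
  rewrite ler_wpM2r ?sqr_ge0// -natrX ler_nat expnS.
  by rewrite (leq_trans (leqnSn n))// leq_pmulr.
rewrite /dotv -[n in n%:R]card_ord -sumr_const mulr_suml.
apply: ler_sum => i _; rewrite mul1r -expr2 -real_normK ?num_real//.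
by rewrite lerXn2r ?nnegrE.
Qed.

(** A coordinate box is compact for the entrywise topology; the comparison of the two norms turns
    its cluster point into a Euclidean one. *)
Lemma bounded_cluster_point (x : nat -> 'rV[R]_n) (B : R) :
  (forall k, enorm (x k) <= B) -> exists p, cluster_points x p.
Proof.
move=> xB.
have boxc : compact [set v : 'rV[R]_n | forall i, v ord0 i \in `[(- B), B]].
  apply: (@rV_compact _ _ (fun=> `[(- B), B]%classic)) => _.
  exact: segment_compact.
have [|p [_ pc]] := boxc (x @ \oo) _.
  exists 0%N => // k _ /= i; rewrite in_itv /= -ler_norml.
  by rewrite (le_trans (ler_coord_enorm _ i)).
exists p => e e0 N; pose a := e / 2 / n.+1%:R.
have a0 : 0 < a by rewrite !divr_gt0.
have tailN : (x @ \oo) [set z | exists2 k, (N <= k)%N & z = x k].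
  by exists N => // k /= Nk; exists k.
have [z [[k Nk ->] [_ pz]]] := pc _ _ tailN (nbhsx_ballx p a a0).
exists k; split=> //; apply: (@le_lt_trans _ _ (n.+1%:R * a)).
  apply: ler_enorm_coord => [|i]; first exact: ltW.
  by rewrite 2!mxE distrC ltW//; exact: pz.
by rewrite mulrC /a divfK ?pnatr_eq0//; lra.
Qed.

(** Otherwise iterates of arbitrarily large index avoid [U]; being bounded they cluster at a point
    of [U], and openness puts one of them back in [U]. *)
Lemma eventually_mem_open (x : nat -> 'rV[R]_n) (B : R) (U : set 'rV[R]_n) :
  (forall k, enorm (x k) <= B) -> eopen U -> cluster_points x `<=` U ->
  exists N, forall k, (N <= k)%N -> U (x k).
Proof.
move=> xB Uo xU; apply: contrapT => /forallNP noN.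
have /choice [s sP] : forall N, exists k, (N <= k)%N /\ ~ U (x k).
  by move=> N; have /existsNP[k /not_implyP[]] := noN N; exists k.
have [p pc] := @bounded_cluster_point (x \o s) B (fun k => xB (s k)).
have /xU/Uo[r [r0 rU]] : cluster_points x p.
  move=> e e0 N; have [k [Nk kp]] := pc e e0 N; exists (s k); split=> //.
  exact: leq_trans Nk (sP k).1.
by have [k [_ /rU]] := pc r r0 0%N; case: (sP k).
Qed.

End Euclidean.

(** * Convex functions with locally Lipschitz gradient: cocoercivity on balls *)

Section ConvexGradient.
Context {R : realType} {n : nat}.
Variables (h : 'rV[R]_n -> R) (gradh : 'rV[R]_n -> 'rV[R]_n).
Hypothesis gradP : forall u (e : R), 0 < e ->
  exists d : R, 0 < d /\ forall z, enorm (z - u) < d ->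
    `|h z - h u - dotv (gradh u) (z - u)| <= e * enorm (z - u).

Lemma grad_along_ray u v (e : R) : 0 < e -> exists t : R, [/\ 0 < t, t <= 1 &
  `|h (u + t *: v) - h u - t * dotv (gradh u) v| <= t * (e * enorm v)].
Proof.
move=> e0; have [d [d0 dP]] := gradP u e e0.
have v1 : 0 < 1 + enorm v by rewrite ltr_wpDr ?enorm_ge0.
(* Division by [1 + enorm v] covers [v = 0]; the cap at 1 keeps [u + t *: v] on the segment, where
   convexity applies. *)
pose t := Num.min 1 (d / 2 / (1 + enorm v)).
have t0 : 0 < t by rewrite lt_min ltr01 !divr_gt0.
exists t; split=> //; first by rewrite ge_min lexx.
have := dP (u + t *: v); rewrite addrC addKr dotvZr enormZ gtr0_norm// mulrCA.
apply; apply: (@le_lt_trans _ _ (d / 2 / (1 + enorm v) * enorm v)).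
  by rewrite ler_wpM2r ?enorm_ge0// ge_min lexx orbT.
rewrite mulrAC ltr_pdivrMr//; have := enorm_ge0 v; nra.
Qed.

(** Testing the subgradient inequality in the direction [w - gradh u] bounds the squared norm of
    this vector by any [e] times its norm. *)
Lemma subgradient_eq_grad u w :
  (forall z, h u + dotv w (z - u) <= h z) -> w = gradh u.
Proof.
move=> wP; apply/eqP; rewrite -subr_eq0; apply/eqP/enorm_eq0.
set v := w - gradh u; apply/eqP; rewrite eq_le enorm_ge0 andbT.
apply/ler_addgt0Pr => e e0; rewrite add0r.
have [t [t0 _ tP]] := grad_along_ray u v e e0.
have := wP (u + t *: v).
rewrite [u + _ - u]addrAC subrr add0r dotvZr => wt.
have vw : dotv w v - dotv (gradh u) v = enorm v ^+ 2 by rewrite enorm_sqr -dotvBl.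
have : enorm v ^+ 2 <= e * enorm v.
  rewrite -vw -(ler_pM2l t0) mulrBr (le_trans _ tP)// (le_trans _ (ler_norm _))//.
  by rewrite lerD2r; lra.
have := enorm_ge0 v; rewrite le_eqVlt => /orP[/eqP <- _|v0]; first exact: ltW.
by rewrite expr2 ler_pM2r.
Qed.

Hypothesis convh : forall u v (t : R), 0 <= t <= 1 ->
  h (t *: u + (1 - t) *: v) <= t * h u + (1 - t) * h v.

(** Convexity bounds the increment of [h] along the segment by [t * (h z - h u)]; comparing with the
    first-order expansion and cancelling [t] leaves an error [e]. *)
Lemma convex_grad_le u z : h u + dotv (gradh u) (z - u) <= h z.
Proof.
apply/ler_addgt0Pr => e e0; have v0 := enorm_ge0 (z - u).
have v1 : 0 < 1 + enorm (z - u) by rewrite ltr_wpDr.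
have [t [t0 t1 tP]] := grad_along_ray u (z - u) _ (divr_gt0 e0 v1).
have := convh z u; move=> /(_ t); rewrite t1 ltW// => /(_ isT).
have -> : t *: z + (1 - t) *: u = u + t *: (z - u).
  by apply/rowP => i; rewrite !mxE; ring.
have ev : e / (1 + enorm (z - u)) * enorm (z - u) <= e.
  by rewrite mulrAC ler_pdivrMr//; nra.
have := le_trans tP (ler_wpM2l (ltW t0) ev).
rewrite ler_norml => /andP[H _] H'.
by rewrite -(ler_pM2l t0); lra.
Qed.

Hypothesis lipP : forall u, exists r L : R, 0 < r /\ forall z1 z2,
  enorm (z1 - u) < r -> enorm (z2 - u) < r ->
  enorm (gradh z1 - gradh z2) <= L * enorm (z1 - z2).

(** Points with gradient norm above every [k] would cluster somewhere, where the local Lipschitz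
    estimate bounds the gradient. *)
Lemma grad_bounded_on_ball B :
  exists G : R, forall z, enorm z <= B -> enorm (gradh z) <= G.
Proof.
apply: contrapT => /forallNP noG.
have /choice [s sP] : forall k : nat, exists z, enorm z <= B /\ k%:R < enorm (gradh z).
  move=> k; have /existsNP[z /not_implyP[zB /negP]] := noG k%:R.
  by rewrite -ltNge; exists z.
have [p pc] := bounded_cluster_point _ _ (fun k => (sP k).1).
have [r [L [r0 lip]]] := lipP p.
have pr : enorm (p - p) < r by rewrite subrr enorm0.
have bound_ge0 : 0 <= enorm (gradh p) + `|L| * r.
  by rewrite addr_ge0 ?enorm_ge0// mulr_ge0// ltW.
have [k [Nk kp]] := pc r r0 (Num.bound (enorm (gradh p) + `|L| * r)).
have := archi_boundP bound_ge0; rewrite ltNge => /negP; apply.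
rewrite (@le_trans _ _ k%:R) ?ler_nat// (le_trans (ltW (sP k).2))//.
rewrite -[gradh (s k)](subrK (gradh p)) addrC (le_trans (ler_enormD _ _))//.
rewrite lerD2l (le_trans (lip _ _ kp pr))//.
rewrite (le_trans (ler_wpM2r (enorm_ge0 _) (ler_norm L)))//.
by rewrite ler_wpM2l// ltW.
Qed.

(** Pairs with ever larger quotients must come together, since the gradient is bounded, and so both
    enter one neighbourhood with a local constant. Asking for [1 <= L] keeps the later step length
    [(2 * L)^-1] at most 1. *)
Lemma grad_lipschitz_on_ball B : exists L : R, 1 <= L /\ forall z1 z2,
  enorm z1 <= B -> enorm z2 <= B -> enorm (gradh z1 - gradh z2) <= L * enorm (z1 - z2).
Proof.
have [G GP] := grad_bounded_on_ball B.
apply: contrapT => /forallNP noL.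
have /choice [s sP] : forall k : nat, exists z : 'rV[R]_n * 'rV[R]_n,
    [/\ enorm z.1 <= B, enorm z.2 <= B &
    k.+1%:R * enorm (z.1 - z.2) < enorm (gradh z.1 - gradh z.2)].
  move=> k; have := noL k.+1%:R; rewrite ler1n => /not_andP[//|].
  move=> /existsNP[z1 /existsNP[z2 /not_implyP[z1B /not_implyP[z2B /negP]]]].
  by rewrite -ltNge; exists (z1, z2).
have s1B k : enorm (s k).1 <= B by have [] := sP k.
have [p pc] := bounded_cluster_point _ _ s1B.
have [r [L [r0 lip]]] := lipP p.
have r2 : 0 < r / 2 by rewrite divr_gt0.
(* Past this bound [k.+1] is at least [L], and [k.+1 * r] is at least [4 * G], which forces [z1] and
   [z2] within [r / 2] of each other. *)
have K_ge0 : 0 <= `|L| + `|4 * G / r| by rewrite addr_ge0.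
have [k [Nk kp]] := pc _ r2 (Num.bound (`|L| + `|4 * G / r|)).
have Kk : `|L| + `|4 * G / r| <= k.+1%:R.
  by rewrite (le_trans (ltW (archi_boundP K_ge0)))// ler_nat ltnW.
have [z1B z2B sk] := sP k; move: z1B z2B sk kp => /=.
set z1 := (s k).1; set z2 := (s k).2 => z1B z2B sk kp.
have Lk : L <= k.+1%:R by have := ler_norm L; have := normr_ge0 (4 * G / r); lra.
have Gk : 4 * G <= k.+1%:R * r.
  rewrite -ler_pdivrMr//.
  by have := ler_norm (4 * G / r); have := normr_ge0 L; lra.
have z12 : enorm (z1 - z2) < r / 2.
  rewrite -(@ltr_pM2l _ k.+1%:R)// (lt_le_trans sk)//.
  have := ler_enormB (gradh z1) (gradh z2); have := GP _ z1B; have := GP _ z2B; lra.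
have z1p : enorm (z1 - p) < r by lra.
have z2p : enorm (z2 - p) < r.
  by have := ler_enorm_dist z2 z1 p; rewrite (enormBC z2 z1); lra.
move: sk; rewrite ltNge => /negP; apply; rewrite (le_trans (lip _ _ z1p z2p))//.
by rewrite ler_wpM2r// enorm_ge0.
Qed.

(* Evaluate the tangent-plane gap of [h] at [u] in the point obtained from [w] by
   a gradient step of length [1 / (2 L)]: it is nonnegative there. *)
Lemma convex_grad_cocoercive B : exists a : R, 0 < a /\ forall u w,
  enorm u <= B -> enorm w <= B ->
  a * enorm (gradh w - gradh u) ^+ 2 <= h w - h u - dotv (gradh u) (w - u).
Proof.
have [G GP] := grad_bounded_on_ball B.
(* The gradient step moves [w] by at most [2 * |G|], so the enlarged ball contains its endpoint
   [z]. *)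
have [L [L1 lip]] := grad_lipschitz_on_ball (B + 2 * `|G|).
have L0 : 0 < L by lra.
pose s := (2 * L)^-1.
have s0 : 0 < s by rewrite invr_gt0; lra.
have s1 : s <= 1 by rewrite invf_le1; lra.
have sL : s * L = 1 / 2 by rewrite /s; field; rewrite gt_eqF.
exists (s / 2); split; first by rewrite divr_gt0.
move=> u w uB wB; set v := gradh w - gradh u; set z := w - s *: v.
have vG : enorm v <= 2 * `|G|.
  have := ler_enormB (gradh w) (gradh u); have := GP _ uB; have := GP _ wB.
  have := ler_norm G; rewrite -/v; lra.
have sv : enorm (s *: v) <= 2 * `|G|.
  rewrite enormZ gtr0_norm// (le_trans _ vG)// ler_piMl ?enorm_ge0//.
have zB : enorm z <= B + 2 * `|G| by rewrite (le_trans (ler_enormB _ _))// lerD.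
have wB' : enorm w <= B + 2 * `|G| by rewrite (le_trans wB)// lerDl mulr_ge0.
(* Adding [gap] and [step] leaves [s * dotv (gradh z - gradh u) v] as lower bound; replacing
   [gradh z] by [gradh w] costs, by [cross], at most half of [enorm v ^+ 2]. *)
have gap := convex_grad_le u z.
have step := convex_grad_le z w.
have cross : dotv (gradh w - gradh z) v <= L * (s * enorm v) * enorm v.
  rewrite (le_trans (cauchy_schwarz _ _))// ler_wpM2r ?enorm_ge0//.
  by rewrite (le_trans (lip _ _ wB' zB))// /z subKr enormZ gtr0_norm.
have wz : w - z = s *: v by rewrite subKr.
have zu : z - u = (w - u) - s *: v by rewrite addrAC.
move: gap step cross; rewrite wz zu (dotvBr (w - u)) !dotvZr.
have vE : enorm v ^+ 2 = dotv (gradh w) v - dotv (gradh u) v.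
  by rewrite enorm_sqr -dotvBl.
rewrite dotvBl => gap step.
have -> : L * (s * enorm v) * enorm v = s * L * enorm v ^+ 2 by ring.
rewrite sL => cross; rewrite -(ler_pM2l s0) in cross.
by have := congr1 ( *%R s) vE; lra.
Qed.

End ConvexGradient.

(** * Subgradients of the constrained DC objective *)

Section Stationarity.
Context {R : realType} {n : nat}.
Implicit Types (g phi : 'rV[R]_n -> \bar R) (h : 'rV[R]_n -> R) (C : set 'rV[R]_n).

Lemma frechet_limiting_subdiff phi u v :
  frechet_subdiff phi u v -> limiting_subdiff phi u v.
Proof.
move=> uv; exists (fun=> u), (fun=> v); split; [|split; [|split]] => //.
- by move=> e e0; exists 0%N => k _; rewrite subrr enorm0.
- exact: cvg_cst.
- by move=> e e0; exists 0%N => k _; rewrite subrr enorm0.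
Qed.

(** On [C], minimality of [u] bounds [g z - g u] below by [dotv y (z - u)], and expanding [h] costs
    only [e * enorm (z - u)]; off [C] the function is +oo. *)
Lemma dc_frechet_subdiff g h C (c : R) (u y w : 'rV[R]_n) :
  (forall z, g z != -oo%E) -> g u \is a fin_num -> C u ->
  (forall z, C z -> (g u - (dotv y u)%:E <= g z - (dotv y z)%:E)%E) ->
  (forall e : R, 0 < e -> exists d : R, 0 < d /\ forall z, enorm (z - u) < d ->
    `|h z - h u - dotv w (z - u)| <= e * enorm (z - u)) ->
  frechet_subdiff (fun p => (fdc g h p + chi C p - c%:E)%E) u (y - w).
Proof.
move=> gN gu Cu umin hdiff; split.
  by rewrite /fdc /chi asboolT// !(fin_numB, fin_numD) gu.
move=> e e0; have [d [d0 dP]] := hdiff e e0.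
exists d; split=> // z /andP[_ /dP {}dP].
have := gN z; rewrite /fdc /chi (asboolT Cu); move: umin => /(_ z).
case: asboolP => Cz.
  move=> /(_ Cz); rewrite -(fineK gu); case: (g z) => [r| |]//= gz _; last first.
    by rewrite leey.
  rewrite lee_fin in gz; rewrite !adde0 -!EFinB lee_fin.
  move: dP; rewrite ler_norml => /andP[_].
  by rewrite dotvBl !dotvBr; move: gz; lra.
move=> _; rewrite -(fineK gu); case: (g z) => [r| |]//= _; exact: leey.
Qed.

End Stationarity.

(** * Convergence rates from the scalar recursion *)

Section RecursiveRates.
Context {R : realType}.
Variables (d : nat -> R) (theta c : R) (N : nat).
Hypothesis c0 : 0 < c.
Hypothesis d_dec : forall k, (N <= k)%N -> d k.+1 <= d k.
Hypothesis d_cvg : d @ \oo --> 0.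
Hypothesis recd : forall k, (N <= k)%N -> 0 < d k.+1 ->
  d k.+1 `^ (2 * theta) <= c * (d k - d k.+1).

Lemma d_dec_le k m : (N <= k)%N -> (k <= m)%N -> d m <= d k.
Proof.
move=> Nk; elim: m => [|m IHm]; first by rewrite leqn0 => /eqP ->.
rewrite leq_eqVlt => /predU1P[-> //|km].
by rewrite (le_trans (d_dec _ _)) ?(leq_trans Nk km)// IHm.
Qed.

(** By monotonicity a negative value would keep the tail away from its limit 0. *)
Lemma d_ge0 k : (N <= k)%N -> 0 <= d k.
Proof.
move=> Nk; rewrite leNgt; apply/negP => dk.
have dk' : 0 < - d k by rewrite oppr_gt0.
move/cvgrPdist_lt : d_cvg => /(_ _ dk')[K _ KP].
have := KP (maxn K k) (leq_maxl _ _); rewrite /= sub0r normrN.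
have dm := d_dec_le k (maxn K k) Nk (leq_maxr _ _).
by rewrite ler0_norm ?(le_trans dm) ?ltW// ltrN2 ltNge dm.
Qed.

Lemma d_eventually_lt e : 0 < e -> exists K, (N <= K)%N /\ forall k, (K <= k)%N -> d k < e.
Proof.
move=> e0; move/cvgrPdist_lt : d_cvg => /(_ e e0)[K _ KP].
exists (maxn N K); split=> [|k]; first exact: leq_maxl.
rewrite geq_max => /andP[Nk /KP /=]; rewrite sub0r normrN.
by rewrite ger0_norm// d_ge0.
Qed.

(** For [theta = 0] the left side of the recursion is 1, so each step to a positive value costs at
    least [1 / c]; this is impossible once [d] is below [1 / c]. *)
Lemma finite_termination : theta = 0 -> exists K, forall k, (K <= k)%N -> d k = 0.
Proof.
move=> th0; have [K [NK KP]] := d_eventually_lt _ (divr_gt0 ltr01 c0).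
exists K.+1 => -[//|k]; rewrite ltnS => Kk; apply/eqP.
have Nk := leq_trans NK Kk.
rewrite eq_le d_ge0 ?(leq_trans Nk)// andbT leNgt; apply/negP => dk0.
have := recd _ Nk dk0; rewrite th0 mulr0 powRr0; apply/negP; rewrite -ltNge.
have := KP k Kk; rewrite ltr_pdivlMr// => dkc; have := mulr_gt0 c0 dk0; lra.
Qed.

(** Once [d < 1], the exponent [2 * theta <= 1] gives [d k.+1 <= c * (d k - d k.+1)]; solving for
    [d k.+1] yields the ratio [c / (1 + c)]. *)
Lemma linear_rate : 0 < theta <= 1 / 2 -> exists q : R, 0 < q < 1 /\
  exists (a : R) K, forall k, (K <= k)%N -> d k <= a * q ^+ k.
Proof.
move=> /andP[th0 th1]; have c_gt0 := c0; have c1 : 0 < 1 + c by lra.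
pose q := c / (1 + c).
have q0 : 0 < q by rewrite divr_gt0.
exists q; split; first by rewrite q0 /= /q ltr_pdivrMr// mul1r; lra.
have [K [NK KP]] := d_eventually_lt _ ltr01.
have step k : (K <= k)%N -> d k.+1 <= q * d k.
  move=> Kk; have Nk := leq_trans NK Kk.
  have := d_ge0 _ (leq_trans Nk (leqnSn k)); rewrite le_eqVlt => /predU1P[<-|dk0].
    by rewrite mulr_ge0 ?d_ge0// ltW.
  have dk1 : d k.+1 <= d k.+1 `^ (2 * theta).
    apply: ger1_powR; last by lra.
    by rewrite dk0 ltW// KP// (leq_trans Kk).
  have := le_trans dk1 (recd _ Nk dk0).
  rewrite /q mulrAC ler_pdivlMr//; lra.
exists (d K / q ^+ K), K => k Kk; rewrite -(subnKC Kk); elim: (k - K)%N => [|m IHm].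
  by rewrite addn0 divfK// expf_neq0// gt_eqF.
rewrite addnS (le_trans (step _ (leq_addr _ _)))// exprS mulrCA.
by rewrite ler_wpM2l// ltW.
Qed.

Lemma sublinear_rate : 1 / 2 < theta -> exists (a : R) K, forall k, (K <= k)%N ->
  d k <= a * k%:R `^ (1 / (1 - 2 * theta)).
Proof.
move=> th; pose p := 2 * theta - 1; have p0 : 0 < p by rewrite /p; lra.
(* After a nonpositive value monotonicity makes [a = 0] work; otherwise [d] is positive from [N] on
   and can be raised to negative powers. *)
have [[K NK dK]|dpos] := pselect (exists2 K, (N <= K)%N & d K <= 0).
  exists 0, K => k Kk; rewrite mul0r (le_trans _ dK)// d_dec_le//.
have {}dpos k : (N <= k)%N -> 0 < d k.
  by move=> Nk; rewrite ltNge; apply/negP => dk; apply: dpos; exists k.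
(* [u = d ^ (- p)] grows by at least [mu] per step: either [d] is halved, or
   [s ^ (2 theta)] is bounded below and the recursion bounds [u k * (1 - s)]. *)
pose u k := d k `^ (- p).
have u0 k : (N <= k)%N -> 0 < u k by move=> Nk; rewrite powR_gt0// dpos.
have udec k : (N <= k)%N -> u N <= u k.
  move=> Nk; rewrite /u !powRN lef_pV2 ?posrE ?powR_gt0 ?dpos//.
  by rewrite ge0_ler_powR ?nnegrE ?d_ge0 ?(ltW p0)// d_dec_le.
pose mu := Num.min (p * u N / 2) (p * (1 / 2) `^ (2 * theta) / c).
have mu0 : 0 < mu.
  by rewrite lt_min !(divr_gt0, mulr_gt0)// ?u0// powR_gt0.
have step k : (N <= k)%N -> u k + mu <= u k.+1.
  move=> Nk; have Nk1 := leq_trans Nk (leqnSn k).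
  have [dk dk1] := (dpos k Nk, dpos k.+1 Nk1).
  pose s := d k.+1 / d k.
  have s0 : 0 < s by rewrite divr_gt0.
  have dE : d k.+1 = d k * s by rewrite mulrC divfK ?gt_eqF.
  have uE : u k.+1 = u k * s `^ (- p) by rewrite /u dE powRM// ltW.
  have s1 : s <= 1 by rewrite ler_pdivrMr// mul1r d_dec.
  (* Write the power as the exponential of [- p * ln s], then use exp t >= 1 + t and ln s <= s -
     1. *)
  have sp : 1 + p * (1 - s) <= s `^ (- p).
    have lns : ln s <= s - 1 by rewrite -[s in ln s](subrKC 1) le_ln1Dx//; lra.
    rewrite /powR gt_eqF// (le_trans _ (expR_ge1Dx _))// lerD2l.
    by have := ler_wpM2l (ltW p0) lns; lra.
  suff : mu <= u k * (p * (1 - s)).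
    have := u0 k Nk; rewrite uE; nra.
  have [s2|s2] := leP s (1 / 2).
    rewrite ge_min; apply/orP; left.
    have := udec k Nk; have := u0 _ (leqnn N) => uN ukN.
    have : u N * (p * (1/2)) <= u k * (p * (1 - s)).
      by rewrite ler_pM ?(ltW uN) ?mulr_ge0 ?(ltW p0)// ler_pM2l//; lra.
    lra.
  rewrite ge_min; apply/orP; right.
  (* The exponents add up to 1, so after multiplying the recursion by [u k] a factor [d k] cancels
     and only [s] and [u k] remain. *)
  have uk : u k * d k `^ (2 * theta) = d k.
    rewrite /u -powRD; last by rewrite (gt_eqF dk) implybT.
    by rewrite (_ : - p + 2 * theta = 1) ?powRr1 ?ltW// /p; lra.
  have := recd _ Nk dk1; rewrite {1}dE powRM ?(ltW dk) ?(ltW s0)// => H.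
  have : u k * d k `^ (2 * theta) * s `^ (2 * theta) <= u k * (c * (d k - d k.+1)).
    by rewrite -mulrA ler_wpM2l// ltW// u0.
  rewrite uk dE => {}H.
  have H2 : s `^ (2 * theta) <= c * (u k * (1 - s)).
    by rewrite -(ler_pM2l dk); lra.
  have H3 : (1 / 2) `^ (2 * theta) <= s `^ (2 * theta).
    by rewrite ge0_ler_powR ?nnegrE//; lra.
  rewrite ler_pdivrMr//.
  have : p * (1 / 2) `^ (2 * theta) <= p * (c * (u k * (1 - s))).
    by rewrite ler_pM2l// (le_trans H3).
  lra.
have ulin m : mu * m%:R <= u (N + m)%N.
  elim: m => [|m IHm]; first by rewrite mulr0 ltW// u0// addn0.
  rewrite addnS (le_trans _ (step _ (leq_addr _ _)))// -natr1; lra.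
(* From [2 * N] on, [k - N] is at least [k / 2], which explains [mu / 2]; the successor ensures
   [k > 0]. *)
exists ((mu / 2) `^ (- p^-1)), (N + N).+1 => k Nk.
have Nk' : (N <= k)%N by rewrite (leq_trans _ (ltnW Nk))// leq_addr.
have k0 : 0 < k%:R :> R by rewrite ltr0n (leq_trans _ Nk).
have uk : mu / 2 * k%:R <= u k.
  have := ulin (k - N)%N; rewrite subnKC// natrB//.
  have : (N + N)%:R <= k%:R :> R by rewrite ler_nat ltnW.
  rewrite natrD; nra.
have -> : d k = u k `^ (- p^-1).
  by rewrite /u -powRrM mulrNN mulfV ?gt_eqF// powRr1// ltW// dpos.
have -> : 1 / (1 - 2 * theta) = - p^-1 by rewrite div1r -invrN /p opprB.
rewrite -powRM ?divr_ge0 ?(ltW mu0) ?(ltW k0)//.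
rewrite !powRN lef_pV2 ?posrE ?powR_gt0 ?u0 ?mulr_gt0// ?divr_gt0 ?dpos//.
by rewrite ge0_ler_powR ?nnegrE ?invr_ge0 ?(ltW p0)// ?mulr_ge0 ?divr_ge0 ?ltW ?u0 ?dpos.
Qed.

End RecursiveRates.

(** * From the DCA iteration to the scalar recursion *)

Theorem theorem7 (R : realType) (n : nat)
  (g : 'rV[R]_n -> \bar R) (h : 'rV[R]_n -> R) (C : set 'rV[R]_n)
  (rho_g rho_h : R) (x y : nat -> 'rV[R]_n) (fstar : R)
  (M theta : R) (eta : \bar R) (V : set 'rV[R]_n) :
  (* Assumption A *)
  Gamma0 g ->
  (forall u v (t : R), 0 <= t <= 1 ->
     h (t *: u + (1 - t) *: v) <= t * h u + (1 - t) * h v) ->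
  (exists x0, C x0) -> eclosed C -> convex_set C ->
  (exists xs, C xs /\ forall z, C z -> (fdc g h xs <= fdc g h z)%E) ->
  (* convexity moduli *)
  0 <= rho_g -> 0 <= rho_h ->
  (forall u z w, C u -> C z -> esubdiff g u w ->
     (g u + (dotv w (z - u))%:E + (rho_g / 2 * enorm (z - u) ^+ 2)%:E <= g z)%E) ->
  (forall u z v, C u -> C z -> esubdiff (fun p => (h p)%:E) u v ->
     h u + dotv v (z - u) + rho_h / 2 * enorm (z - u) ^+ 2 <= h z) ->
  0 < rho_g + rho_h ->
  (* h differentiable with locally Lipschitz gradient *)
  (exists gradh : 'rV[R]_n -> 'rV[R]_n,
     (forall u (e : R), 0 < e -> exists d : R, 0 < d /\ forall z, enorm (z - u) < d ->
        `|h z - h u - dotv (gradh u) (z - u)| <= e * enorm (z - u)) /\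
     (forall u, exists r L : R, 0 < r /\ forall z1 z2,
        enorm (z1 - u) < r -> enorm (z2 - u) < r ->
        enorm (gradh z1 - gradh z2) <= L * enorm (z1 - z2))) ->
  (* f continuous on dom f *)
  (forall u, fdc g h u \is a fin_num -> forall e : R, 0 < e ->
     exists d : R, 0 < d /\ forall z, fdc g h z \is a fin_num ->
       enorm (z - u) < d -> `|fine (fdc g h z) - fine (fdc g h u)| < e) ->
  (* DCA sequences *)
  dom_subdiff (fun p => (h p)%:E) (x 0%N) ->
  (forall k, esubdiff (fun p => (h p)%:E) (x k) (y k)) ->
  (forall k, C (x k.+1) /\ forall z, C z ->
     (g (x k.+1) - (dotv (y k) (x k.+1))%:E <= g z - (dotv (y k) z)%:E)%E) ->
  (* boundedness *)
  (exists B : R, forall k, enorm (x k) <= B /\ enorm (y k) <= B) ->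
  (* f* = lim f(x^k) *)
  (fun k => fdc g h (x k)) @ \oo --> fstar%:E ->
  (* KL property of Psi = f + chi_C - f* with phi(t) = M t^(1-theta) *)
  0 < M -> 0 <= theta < 1 -> (0 < eta)%E ->
  nbhd_of_set V (cluster_points x) ->
  (forall u, V u ->
     let Psi := fun p => (fdc g h p + chi C p - fstar%:E)%E in
     (0 < Psi u < eta)%E ->
     (1 <= (M * (1 - theta) * powR (fine (Psi u)) (- theta))%:E
             * dist0 (limiting_subdiff Psi u))%E) ->
  (theta = 0 -> exists N : nat, forall k, (N <= k)%N -> fdc g h (x k) = fstar%:E) /\
  (0 < theta <= 1 / 2 -> exists q : R, 0 < q < 1 /\
     exists (c : R) (N : nat), forall k, (N <= k)%N ->
       (`|fdc g h (x k) - fstar%:E| <= (c * q ^+ k)%:E)%E) /\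
  (1 / 2 < theta < 1 -> exists (c : R) (N : nat), forall k, (N <= k)%N ->
       (`|fdc g h (x k) - fstar%:E| <= (c * powR k%:R (1 / (1 - 2 * theta)))%:E)%E).
Proof.
move=> [[gN _] _] hconv _ _ _ _ _ _ _ _ _ [gradh [gradP lipP]] _ _ yP xP [B BP].
move=> /fine_cvgP[[N0 _ f_fin] f_cvg] M0 /andP[th0 th1] eta0 [U [Uo [xU UV]]] KL.
have xB k : enorm (x k) <= B by have [] := BP k.
have yE k : y k = gradh (x k).
  apply: (subgradient_eq_grad h gradh gradP) => z.
  by have [_ /(_ z)] := yP k; rewrite -EFinD lee_fin.
have [a [a0 coco]] := convex_grad_cocoercive h gradh gradP hconv lipP B.
have [N1 x_in_U] := eventually_mem_open x B U xB Uo xU.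
(* A real threshold is chosen because [eta] may be +oo. *)
have [e e0 e_eta] : exists2 e : R, 0 < e & (e%:E <= eta)%E.
  case: eta eta0 {KL} => [r r0| _|//]; first by exists r.
  by exists 1 => //; rewrite leey.
pose d k := fine (fdc g h (x k)) - fstar.
have d_cvg : d @ \oo --> 0.
  by rewrite -(subrr fstar); apply: cvgB => //; exact: cvg_cst.
have [N2 _ d_lt] : \forall k \near \oo, `|0 - d k| < e.
  by move/cvgrPdist_lt : d_cvg; apply.
(* The 1 skips [x 0], which need not lie in [C]: the descent step uses [x k] as a competitor in the
   subproblem defining [x k.+1]. *)
pose N := (maxn 1 (maxn N0 (maxn N1 N2))).
have NP k : (N <= k)%N -> [/\ (0 < k)%N, fdc g h (x k) \is a fin_num, U (x k) & `|d k| < e].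
  rewrite !geq_max => /and4P[k0 N0k N1k N2k]; split=> //.
  - exact: f_fin.
  - exact: x_in_U.
  - by have := d_lt k N2k; rewrite /= sub0r normrN.
have fE k : (N <= k)%N -> (fdc g h (x k) - fstar%:E)%E = (d k)%:E.
  by move=> /NP[_ kf _ _]; rewrite EFinB fineK.
have gE k : (N <= k)%N -> g (x k) = (d k + fstar + h (x k))%:E.
  move=> Nk; have [_ + _ _] := NP k Nk; rewrite /d /fdc.
  by case: (g (x k)) => [r| |]//= _; rewrite !subrK.
have descent k : (N <= k)%N ->
    a * enorm (y k - y k.+1) ^+ 2 <= d k - d k.+1.
  move=> Nk; have [k0 _ _ _] := NP k Nk.
  have Cxk : C (x k) by rewrite -(prednK k0); have [] := xP k.-1.
  have [_ /(_ _ Cxk)] := xP k.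
  rewrite !gE ?(leqW Nk)// -!EFinB lee_fin => opt.
  have := coco (x k) (x k.+1) (xB k) (xB k.+1).
  by rewrite enormBC -!yE dotvBr; lra.
have d_dec k : (N <= k)%N -> d k.+1 <= d k.
  move=> /descent; have := mulr_ge0 (ltW a0) (sqr_ge0 (enorm (y k - y k.+1))); lra.
(* The KL inequality bounds [d k.+1] to the power [theta] by [M * (1 - theta)] times the norm of
   [y k - y k.+1]; squaring and inserting [descent] gives this constant. *)
pose c := (M * (1 - theta)) ^+ 2 / a.
have Mth0 : 0 < M * (1 - theta) by rewrite mulr_gt0// subr_gt0.
have c0 : 0 < c by rewrite divr_gt0// exprn_gt0.
have rec k : (N <= k)%N -> 0 < d k.+1 -> d k.+1 `^ (2 * theta) <= c * (d k - d k.+1).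
  move=> Nk dk0; have Nk1 := leqW Nk; have [_ fk1 Uk1 dk_lt] := NP k.+1 Nk1.
  have [Cxk1 opt] := xP k.
  have := KL _ (UV _ Uk1); set Psi := (fun p => _) => /=.
  have PsiE : Psi (x k.+1) = (d k.+1)%:E by rewrite /Psi /chi asboolT// adde0 fE.
  have Psi_lt : (0 < Psi (x k.+1) < eta)%E.
    rewrite PsiE lte_fin dk0 /=; apply: lt_le_trans e_eta.
    by rewrite lte_fin; exact: le_lt_trans (ler_norm _) dk_lt.
  move=> /(_ Psi_lt); rewrite PsiE /=.
  have /frechet_limiting_subdiff stat : frechet_subdiff Psi (x k.+1) (y k - y k.+1).
    rewrite (yE k.+1); apply: dc_frechet_subdiff => //; last exact: gradP.
    by rewrite gE.
  have dist_le : (dist0 (limiting_subdiff Psi (x k.+1)) <= (enorm (y k - y k.+1))%:E)%E.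
    by apply: ereal_inf_lbound; exists (y k - y k.+1).
  have m0 : 0 <= M * (1 - theta) * d k.+1 `^ (- theta).
    by rewrite mulr_ge0 ?powR_ge0// ltW.
  rewrite -lee_fin in m0; move=> /le_trans /(_ (lee_wpmul2l m0 dist_le)).
  rewrite -EFinM lee_fin powRN [leRHS]mulrAC ler_pdivlMr ?powR_gt0// mul1r => dth.
  rewrite mulrC powRrM powR_mulrn ?powR_ge0//.
  apply: (@le_trans _ _ ((M * (1 - theta) * enorm (y k - y k.+1)) ^+ 2)).
    by rewrite lerXn2r ?nnegrE ?powR_ge0// mulr_ge0 ?enorm_ge0// ltW.
  rewrite exprMn /c -mulrA ler_wpM2l ?sqr_ge0//.
  by rewrite mulrC ler_pdivlMr// mulrC descent.
have absE k : (N <= k)%N -> `|fdc g h (x k) - fstar%:E|%E = (d k)%:E.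
  by move=> Nk; rewrite fE//= ger0_norm// (d_ge0 d N).
split; [|split].
- move=> /(finite_termination d theta c N c0 d_dec d_cvg rec)[K KP].
  exists (maxn N K) => k; rewrite geq_max => /andP[Nk Kk].
  have [_ fk _ _] := NP k Nk; rewrite -(fineK fk).
  by have /eqP := KP k Kk; rewrite subr_eq0 => /eqP ->.
- move=> /(linear_rate d theta c N c0 d_dec d_cvg rec)[q [q01 [b [K KP]]]].
  exists q; split=> //; exists b, (maxn N K) => k.
  by rewrite geq_max => /andP[Nk Kk]; rewrite absE// lee_fin KP.
- move=> /andP[/(sublinear_rate d theta c N c0 d_dec d_cvg rec)[b [K KP]] _].
  exists b, (maxn N K) => k.
  by rewrite geq_max => /andP[Nk Kk]; rewrite absE// lee_fin KP.
Qed.
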